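(* Let $m\in\mathbb N$, $\rho\in(0,1)$, and let $(Z^1_n)_{n\in\mathbb N},\dots,(Z^m_n)_{n\in\mathbb N}$ be $m$ independent sequences, each consisting of i.i.d. integrable random variables with $Z^i_n>0$ a.s. For $i=1,\dots,m$ put $$S^i_n=\max\{Z^i_1,\dots,Z^i_n\},\qquad X^i_n=\rho^nS^i_n,\qquad g_i(z)=E\left(\max\left\{1,\frac{Z^i_1}{z}\right\}\right)\ (z>0),$$ and $X_n=\prod_{i=1}^mX^i_n$. Then the stopping problem for $(X_n)_{n\in\mathbb N}$ is a monotone case problem, and the myopic stopping time $$\tau^*=\inf\left\{k:\ \prod_{i=1}^mg_i(S^i_k)\leq\rho^{-m}\right\}$$ is optimal, i.e. $EX_{\tau^*}=\sup_\tau EX_\tau$.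
   Context: $\mathbb N=\{1,2,\dots\}$. The filtration is $\mathcal A_n=\sigma(Z^i_k: k\le n,\ i=1,\dots,m)$. Stopping times are with respect to $(\mathcal A_n)$, take values in $\{1,2,\dots\}\cup\{\infty\}$, and $X_\infty:=\liminf_{n\to\infty}X_n$; the supremum is over all such stopping times $\tau$ for which $EX_\tau$ exists. The stopping problem for an adapted integrable sequence $(X_n)_{n\in\mathbb N}$ is called a monotone case problem if for all $n\in\mathbb N$ $$\{E(X_{n+1}\mid\mathcal A_n)\leq X_n\}\subseteq\{E(X_{n+2}\mid\mathcal A_{n+1})\leq X_{n+1}\}$$ (up to null sets). Its myopic stopping time is $\inf\{n: E(X_{n+1}\mid\mathcal A_n)\leq X_n\}$, with $\inf\emptyset=\infty$. *)

(* Defs.v *)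
From HB Require Import structures.
From mathcomp Require Import all_boot all_order all_algebra finmap.
From mathcomp Require Import all_classical all_reals all_analysis.

Set Implicit Arguments.
Unset Strict Implicit.
Unset Printing Implicit Defensive.

Import Order.TTheory GRing.Theory Num.Theory.
Import numFieldNormedType.Exports.

Local Open Scope classical_set_scope.
Local Open Scope ring_scope.

(* Sequences (X_n) with n = 1, 2, ... are functions on nat whose value at 0 is
   ignored: every condition below is restricted to indices n >= 1. *)

Section sigma_algebras.
Context d (T : measurableType d) (R : realType).

(* sigma(X_i : i \in D) *)
Definition sigma_of (I : Type) (D : set I) (X : I -> T -> R) : set (set T) :=
  <<s \bigcup_(i in D) preimage_set_system setT (X i) measurable >>.

Definition measurable_wrt (G : set (set T)) (Y : T -> R) : Prop :=
  preimage_set_system setT Y measurable `<=` G.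

End sigma_algebras.

Section independence.
Context d (T : measurableType d) (R : realType) (P : probability T R).

Definition independent_classes (I : choiceType) (D : set I)
    (F : I -> set (set T)) : Prop :=
  forall J : {fset I}, [set` J] `<=` D ->
  forall A : I -> set T, (forall i, i \in J -> F i (A i)) ->
  P (\bigcap_(i in [set` J]) A i) = (\prod_(i <- J) P (A i))%E.

Definition independent_RVs (I : choiceType) (D : set I) (X : I -> T -> R) :
    Prop :=
  independent_classes D (fun i => preimage_set_system setT (X i) measurable).

(* Equality of laws is required on measurable sets only: the set function
   [distribution P X] carries no information on the others. *)
Definition identically_distributed (X Y : {RV P >-> R}) : Prop :=
  forall B, measurable B -> distribution P X B = distribution P Y B.

Definition iid (Z : nat -> {RV P >-> R}) : Prop :=
  independent_RVs [set n | (1 <= n)%N] (fun n => Z n : T -> R) /\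
  forall n, (1 <= n)%N -> identically_distributed (Z n) (Z 1%N).

Definition independent_sequences (I : choiceType)
    (Z : I -> nat -> {RV P >-> R}) : Prop :=
  independent_classes setT
    (fun i => sigma_of [set n | (1 <= n)%N] (fun n => Z i n : T -> R)).

End independence.

Section conditional_expectation.
Context d (T : measurableType d) (R : realType) (P : probability T R).

Definition is_condexp (G : set (set T)) (X Y : T -> R) : Prop :=
  [/\ measurable_wrt G Y,
      P.-integrable setT (EFin \o Y) &
      forall A, G A ->
        (\int[P]_(w in A) (Y w)%:E = \int[P]_(w in A) (X w)%:E)%E].

(* A version of E(X | G). For G a sub-sigma-algebra and X integrable, versions
   exist (Radon-Nikodym) and agree almost surely; the default value 0 is only
   used when there is no version. *)
Definition condexp (G : set (set T)) (X : T -> R) : T -> R :=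
  xget (fun=> 0) [set Y | is_condexp G X Y].

End conditional_expectation.

Section optimal_stopping.
Context d (T : measurableType d) (R : realType) (P : probability T R).
Variables (A : nat -> set (set T)) (X : nat -> T -> R).

(* Random times take values in [option nat], where [None] is infinity. *)
Definition is_stopping_time (tau : T -> option nat) : Prop :=
  (forall w, tau w <> Some 0%N) /\
  forall n, (1 <= n)%N -> A n [set w | tau w = Some n].

(* Infimum of a set of naturals, with inf set0 = infinity. *)
Definition inf_time (C : set nat) : option nat :=
  if pselect (exists n, `[< C n >]) is left h then Some (ex_minn h) else None.

(* X_tau, with X_oo := liminf X_n *)
Definition stopped (tau : T -> option nat) (w : T) : \bar R :=
  if tau w is Some n then (X n w)%:E else limn_einf (fun n => (X n w)%:E).

Definition expectation_exists (f : T -> \bar R) : Prop :=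
  (\int[P]_w f^\+ w < +oo)%E \/ (\int[P]_w f^\- w < +oo)%E.

Definition optimal_stopping_time (tau : T -> option nat) : Prop :=
  [/\ is_stopping_time tau, expectation_exists (stopped tau) &
      (\int[P]_w stopped tau w =
       ereal_sup [set \int[P]_w stopped sigma w |
         sigma in [set sigma | is_stopping_time sigma /\
                               expectation_exists (stopped sigma)]])%E].

(* {E(X_(n+1) | A_n) <= X_n} *)
Definition myopic_stop (n : nat) : set T :=
  [set w | condexp P (A n) (X n.+1) w <= X n w].

Definition monotone_case_problem : Prop :=
  [/\ forall n, (1 <= n)%N -> measurable_wrt (A n) (X n),
      forall n, (1 <= n)%N -> P.-integrable setT (EFin \o X n) &
      forall n, (1 <= n)%N ->
        {ae P, forall w, myopic_stop n w -> myopic_stop n.+1 w}].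

Definition myopic_time (w : T) : option nat :=
  inf_time [set n | (1 <= n)%N /\ myopic_stop n w].

End optimal_stopping.

Section product_problem.
Context d (T : measurableType d) (R : realType) (P : probability T R).
Variables (m : nat) (rho : R) (Z : 'I_m -> nat -> {RV P >-> R}).

Definition filtration (n : nat) : set (set T) :=
  sigma_of [set ik : 'I_m * nat | (1 <= ik.2 <= n)%N]
    (fun ik => Z ik.1 ik.2 : T -> R).

Definition running_max (i : 'I_m) (n : nat) (w : T) : R :=
  \big[Num.max/Z i 1%N w]_(1 <= k < n.+1) Z i k w.

Definition discounted_max (i : 'I_m) (n : nat) (w : T) : R :=
  rho ^+ n * running_max i n w.

Definition reward (n : nat) (w : T) : R :=
  \prod_(i < m) discounted_max i n w.

Definition gfun (i : 'I_m) (z : R) : R :=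
  fine 'E_P[fun w => Num.max 1 (Z i 1%N w / z)].

Definition tau_star (w : T) : option nat :=
  inf_time [set k | (1 <= k)%N /\
    \prod_(i < m) gfun i (running_max i k w) <= rho ^- m].

End product_problem.

(* Main.v *)
Require Import Defs.
From HB Require Import structures.
From mathcomp Require Import all_boot all_order all_algebra finmap.
From mathcomp Require Import all_classical all_reals all_analysis.
From mathcomp Require Import measurable_realfun.

Set Implicit Arguments.
Unset Strict Implicit.
Unset Printing Implicit Defensive.

Import Order.TTheory GRing.Theory Num.Theory.
Import numFieldNormedType.Exports.

Local Open Scope classical_set_scope.
Local Open Scope ring_scope.

(* Write S^i_n for the running maxima and g_i for [gfun]. Given A_n, the variables
   Z^i_(n+1) are independent of A_n and of each other, so
   E(X_(n+1) | A_n) = X_n rho^m prod_i g_i(S^i_n) almost surely, and the myopic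
   region at time n is {prod_i g_i(S^i_n) <= rho^-m}; as each g_i is nonincreasing
   on the positive reals, this region increases with n. For any stopping time tau,
   E X_(tau /\ (n+1)) - E X_(tau /\ n) is the integral over {tau > n} of
   E(X_(n+1) | A_n) - X_n, which is positive exactly before tau*; hence
   E X_(tau /\ n) <= E X_(tau* /\ n) <= E X_tau* + E X_n. Finally
   E X_n <= (n rho^n)^m prod_i E Z^i_1 tends to 0, and Fatou's lemma gives
   E X_tau <= E X_tau*. *)

(** * Independence of the variables of the array *)

(** The hypotheses give product formulas for finite families only, while the conditional expectation
    needs each Z^i_(n+1) to be independent of A_n and of the other variables of time n+1 jointly. A
    uniqueness argument for measures turns them into one statement: a single cell (j, k) of the
    array is independent of the sigma-algebra of all other cells up to a finite time. The Z^i_(n+1)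
    are then integrated out one by one, everything else serving as a weight; the same device bounds
    E X_n. Positivity holds only almost surely, so the myopic region and {prod_i g_i(S^i_n) <=
    rho^-m} may differ on a null set, and the filtration is not completed. The stopping argument
    therefore works with abstract regions [C n] in A_n that agree almost surely with the myopic
    ones. The passage to the limit rests on nonnegativity and E X_n -> 0 instead of domination. *)

Section independent_generators.
Context d (T : measurableType d) (R : realType) (P : probability T R).
Local Open Scope ereal_scope.

(** The finite measures A |-> P (A [&] C) and A |-> P C * P A agree on the pi-system [G], which
    contains the whole space, hence on the sigma-algebra it generates. *)
Lemma indep_generated (G : set (set T)) (C : set T) :
  setI_closed G -> G setT -> G `<=` measurable -> measurable C ->
  (forall A, G A -> P (A `&` C) = P A * P C) ->
  forall A, <<s G >> A -> P (A `&` C) = P A * P C.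
Proof.
move=> GI GT Gm mC PG A sA.
have r0 : (0 <= fine (P C))%R by exact: fine_ge0.
pose r : {nonneg R} := NngNum r0.
rewrite muleC.
have -> : P C * P A = mscale r P A.
  by rewrite /mscale /= fineK// fin_num_measure.
have -> : P (A `&` C) = mrestr P mC A by [].
apply: (@g_sigma_algebra_measure_unique _ _ _ G Gm (fun=> setT)) => //.
- by rewrite bigcup_const//; exists 0%N.
- move=> B GB.
rewrite /= /mrestr /mscale PG// fineK ?fin_num_measure//.
  by rewrite muleC.
- by move=> _; rewrite /= /mrestr setTI -ge0_fin_numE ?fin_num_measure.
Qed.

End independent_generators.

Section cells.
Context d (T : measurableType d) (R : realType) (P : probability T R).
Variables (m : nat) (Z : 'I_m -> nat -> {RV P >-> R}).
Hypotheses (hindep : independent_sequences Z) (hiid : forall i, iid (Z i)).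

Definition grid (N : nat) : set ('I_m * nat) := [set ik | (1 <= ik.2 <= N)%N].

Definition rect (N : nat) (B : 'I_m -> nat -> set R) : set T :=
  \bigcap_(ik in grid N) (Z ik.1 ik.2 @^-1` B ik.1 ik.2).

Lemma measurable_rect N B : (forall i k, measurable (B i k)) ->
  measurable (rect N B).
Proof.
move=> mB; apply: fin_bigcap_measurable => [|ik _].
  apply: (@sub_finite_set _ _ ([set: 'I_m] `*` `I_N.+1)) => [[i k] /andP[_ kN]|].
    by split.
  exact: finite_setX.
exact: measurable_funPTI.
Qed.

Lemma rect_rows N B :
  rect N B = \bigcap_i \bigcap_(k in [set k | (1 <= k <= N)%N])
    (Z i k @^-1` B i k).
Proof.
apply/seteqP; split=> [w h i _ k /= kN|w h [i k] /= kN].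
  exact: (h (i, k)).
exact: (h i I k).
Qed.

(** Independence is used twice: between the rows, whose events lie in the row sigma-algebras, and
    then inside each row. The finite sets [J] and [L] only translate the index ranges. *)
Lemma prob_rect N B : (forall i k, measurable (B i k)) ->
  P (rect N B) = (\prod_(i < m) \prod_(1 <= k < N.+1) P (Z i k @^-1` B i k))%E.
Proof.
move=> mB; rewrite rect_rows.
pose J : {fset 'I_m} := [fset i in enum 'I_m]%fset.
pose L : {fset nat} := [fset k in index_iota 1 N.+1]%fset.
have inJ i : i \in J by rewrite inE mem_enum.
have inL k : (k \in L) = (1 <= k <= N)%N by rewrite inE mem_index_iota ltnS.
pose row i := \bigcap_(k in [set` L]) (Z i k @^-1` B i k).
have rowE i : \bigcap_(k in [set k | (1 <= k <= N)%N]) (Z i k @^-1` B i k) = row i.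
  by apply: eq_bigcapl; split=> k /=; rewrite inL.
under eq_bigcapr do rewrite rowE.
have -> : \bigcap_i row i = \bigcap_(i in [set` J]) row i.
  by apply: eq_bigcapl; split=> i //= _; exact: inJ.
rewrite (hindep (J := J))//; last first.
  move=> i _; rewrite /row /sigma_of.
  set G := \bigcup_(n in _) _.
  apply: (@fin_bigcap_measurable _ (g_sigma_algebraType G)) => // k /=.
  rewrite inL => /andP[k1 _]; apply: sub_sigma_algebra; exists k => //.
  by exists (B i k) => //; rewrite setTI.
transitivity (\prod_(i <- index_enum 'I_m) P (row i))%E.
  apply: perm_big; apply: uniq_perm; [exact: fset_uniq|exact: index_enum_uniq|].
  by move=> i; rewrite [LHS]inJ mem_index_enum.
apply: eq_bigr => i _; rewrite /row (proj1 (hiid i) L).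
- apply: perm_big; apply: uniq_perm; [exact: fset_uniq|exact: iota_uniq|move=> k].
  by rewrite [LHS]inL mem_index_iota ltnS.
- by move=> k /=; rewrite inL => /andP[].
- by move=> k _; exists (B i k) => //; rewrite setTI.
Qed.

Definition other_cells N j k : set ('I_m * nat) :=
  [set ik | (1 <= ik.2 <= N)%N /\ ik != (j, k)].

(** For [D := grid N] the generated sigma-algebra is [filtration Z N] up to unfolding. *)
Definition cell_gen (D : set ('I_m * nat)) : set (set T) :=
  \bigcup_(ik in D) preimage_set_system setT (Z ik.1 ik.2 : T -> R) measurable.

Lemma cell_gen_measurable D : cell_gen D `<=` measurable.
Proof.
by move=> _ [ik _ [B mB <-]]; rewrite setTI; exact: measurable_funPTI.
Qed.

Lemma sub_cell_gen D D' : D `<=` D' -> <<s cell_gen D >> `<=` <<s cell_gen D' >>.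
Proof. by move=> DD'; apply: sub_sigma_algebra2; exact: bigcup_subset. Qed.

(** A pi-system generating the sigma-algebra of the cells other than (j, k). *)
Let rects N j k : set (set T) :=
  [set A | exists B, [/\ forall i l, measurable (B i l), B j k = setT &
    A = rect N B]].

(** A rectangle unconstrained at (j, k), cut by an event on that cell, is again a rectangle, so
    [prob_rect] gives the product formula on [rects]; [indep_generated] extends it. *)
Lemma indep_cell N j k A C : (1 <= k <= N)%N ->
  <<s cell_gen (other_cells N j k) >> A -> measurable C ->
  P (A `&` Z j k @^-1` C) = (P A * P (Z j k @^-1` C))%E.
Proof.
move=> kN sA mC; apply: (@indep_generated _ _ _ _ (rects N j k)).
- move=> _ _ [B [mB Bjk ->]] [B' [mB' B'jk ->]].
  exists (fun i l => B i l `&` B' i l); split.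
  + by move=> i l; exact: measurableI.
  + by rewrite Bjk B'jk setTI.
  + by rewrite /rect -bigcapI.
- by exists (fun _ _ => setT); split=> //; apply/seteqP; split=> // w _.
- by move=> _ [B [mB _ ->]]; exact: measurable_rect.
- exact: measurable_funPTI.
- move=> _ [B [mB Bjk ->]].
  pose B' i l := if (i, l) == (j, k) then C else B i l.
  have mB' i l : measurable (B' i l) by rewrite /B'; case: ifP.
  have -> : rect N B `&` Z j k @^-1` C = rect N B'.
    apply/seteqP; split=> [w [h hC] [i l] /= lN|w h].
      rewrite /B'; case: eqP => [[-> ->]//|_]; exact: (h (i, l)).
    split=> [[i l] /= lN|].
      have := h (i, l) lN; rewrite /= /B'; case: eqP => // -[-> ->] _.
      by rewrite Bjk.
    by have := h (j, k) kN; rewrite /= /B' eqxx.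
  rewrite !prob_rect// (bigD1 j)//= [in RHS](bigD1 j)//=.
  have kin : k \in index_iota 1 N.+1 by rewrite mem_index_iota ltnS.
  rewrite (bigD1_seq k)//= ?iota_uniq// [in RHS](bigD1_seq k)//= ?iota_uniq//.
  rewrite Bjk preimage_setT probability_setT mul1e /B' eqxx.
  rewrite [RHS]muleC muleA; congr (_ * _ * _)%E.
    by apply: eq_bigr => l lk; rewrite xpair_eqE (negbTE lk) andbF.
  apply: eq_bigr => i ij; apply: eq_bigr => l _.
  by rewrite xpair_eqE (negbTE ij).
(* Each generator is a rectangle constrained at one cell only, which is not (j, k). *)
- move: A sA; apply: sub_sigma_algebra2 => _ [[i l] [/= lN ne] [B mB <-]].
  exists (fun a b => if (a, b) == (i, l) then B else setT); split.
  + by move=> a b; case: ifP.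
  + by rewrite eq_sym (negbTE ne).
  + rewrite setTI; apply/seteqP; split=> [w Bw [a b] /= _|w h].
      by case: eqP => // -[-> ->].
    by have := h (i, l) lN; rewrite /= eqxx.
Qed.

End cells.

Arguments grid : clear implicits.

(** * Integration of independent variables *)

Lemma measurable_wrtP d (T : measurableType d) (R : realType)
    (G : set (set T)) (Y : T -> R) :
  measurable_wrt <<s G >> Y <->
  measurable_fun [set: g_sigma_algebraType G] (Y : g_sigma_algebraType G -> R).
Proof.
split=> [h _ B mB|h _ [B mB <-]].
  by apply: h; exists B.
exact: h.
Qed.

Lemma measurable_fun_sub_sigma d (T : measurableType d) d' (E : measurableType d')
    (G : set (set T)) (Y : T -> E) : G `<=` measurable ->
  measurable_fun [set: g_sigma_algebraType G] (Y : g_sigma_algebraType G -> E) ->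
  measurable_fun [set: T] Y.
Proof.
move=> Gm mY _ B mB.
exact: (smallest_sub (@sigma_algebra_measurable _ T) Gm (mY measurableT B mB)).
Qed.

Section integral_independent.
Context d (T : measurableType d) (R : realType) (P : probability T R).
Local Open Scope ereal_scope.

(* The law of [(V, W)] is the product of the laws of [V] and [W], so this is
   Tonelli's theorem. *)
Lemma integral_indep (G : set (set T)) d' (E : measurableType d')
    (V : T -> E) (W : {RV P >-> R}) (f : E * R -> \bar R) :
  G `<=` measurable ->
  measurable_fun [set: g_sigma_algebraType G] (V : g_sigma_algebraType G -> E) ->
  (forall A B, <<s G >> A -> measurable B ->
    P (A `&` W @^-1` B) = P A * P (W @^-1` B)) ->
  measurable_fun [set: E * R] f -> (forall x, 0 <= f x) ->
  \int[P]_w f (V w, W w) = \int[P]_w \int[P]_w' f (V w, W w').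
Proof.
move=> Gm mV ind mf f0.
have mV' := measurable_fun_sub_sigma Gm mV.
pose V' : {mfun T >-> E} := mfun_Sub (mem_set mV').
have mVW : measurable_fun setT (fun w => (V w, W w)).
  by apply/measurable_fun_pairP; split => //=; exact: measurable_funP.
pose VW : {mfun T >-> (E * R)%type} := mfun_Sub (mem_set mVW).
rewrite -[LHS](@ge0_integral_distribution _ _ _ _ _ P VW)//.
rewrite -(@eq_measure_integral _ _ _ _ (distribution P VW)
  (distribution P V' \x distribution P W)); last first.
  move=> A mA _; apply: product_measure_unique => // B C mB mC.
  rewrite /distribution /pushforward.
  have := ind (V @^-1` B) C.
  rewrite -[V @^-1` B]setTI => /(_ (mV measurableT _ mB) mC).
  by rewrite setTI.
rewrite fubini_tonelli1//.
rewrite (@ge0_integral_distribution _ _ _ _ _ P V'); last 2 first.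
- exact: measurable_fun_fubini_tonelli_F.
- by move=> x; exact: integral_ge0.
apply: eq_integral => w _ /=.
rewrite /fubini_F (@ge0_integral_distribution _ _ _ _ _ P W)//.
exact: measurableT_comp.
Qed.

(* The factors are replaced one at a time: at step [j] the other factors,
   replaced or not, form together with [U] a [G j]-measurable weight [V]. *)
Lemma integral_prod_replace (m : nat) (G : 'I_m -> set (set T))
    (U : T -> R) (a b : 'I_m -> T -> R) :
  (forall w, 0 <= U w)%R ->
  (forall i w, 0 <= a i w)%R -> (forall i w, 0 <= b i w)%R ->
  (forall j, measurable_wrt <<s G j >> U) ->
  (forall i j, i != j -> measurable_wrt <<s G j >> (a i)) ->
  (forall i j, i != j -> measurable_wrt <<s G j >> (b i)) ->
  (forall j V, (forall w, 0 <= V w)%R -> measurable_wrt <<s G j >> V ->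
    \int[P]_w (V w * a j w)%:E <= \int[P]_w (V w * b j w)%:E) ->
  \int[P]_w (U w * \prod_(i < m) a i w)%:E <=
  \int[P]_w (U w * \prod_(i < m) b i w)%:E.
Proof.
move=> U0 a0 b0 mU ma mb step.
pose mix k (i : 'I_m) := if (i < k)%N then b i else a i.
have mix0 k i w : (0 <= mix k i w)%R by rewrite /mix; case: ifP.
suff H k : (k <= m)%N -> \int[P]_w (U w * \prod_(i < m) a i w)%:E <=
    \int[P]_w (U w * \prod_(i < m) mix k i w)%:E.
  have := H m (leqnn m); rewrite /mix.
  by under [in X in _ <= X -> _]eq_integral do
    under eq_bigr do rewrite ltn_ord.
elim: k => [_|k ih km]; first exact: lexx.
apply: (le_trans (ih (ltnW km))).
pose j := Ordinal km.
pose V w := (U w * \prod_(i < m | i != j) mix k i w)%R.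
have V0 w : (0 <= V w)%R by rewrite mulr_ge0// prodr_ge0.
have mV : measurable_wrt <<s G j >> V.
  apply/measurable_wrtP/measurable_funM; first exact/measurable_wrtP.
  under eq_fun do rewrite -big_filter.
  apply: measurable_prod => i; rewrite mem_filter => /andP[ij _].
  by apply/measurable_wrtP; rewrite /mix; case: ifP => _; [exact: mb|exact: ma].
rewrite (_ : \int[P]_w (U w * \prod_(i < m) mix k i w)%:E =
    \int[P]_w (V w * a j w)%:E); last first.
  apply: eq_integral => w _; rewrite (bigD1 j)//= /V -mulrA.
  by rewrite {1}/mix /= ltnn [(a j w * _)%R]mulrC.
rewrite (_ : \int[P]_w (U w * \prod_(i < m) mix k.+1 i w)%:E =
    \int[P]_w (V w * b j w)%:E); last first.
  apply: eq_integral => w _; rewrite (bigD1 j)//= /V -mulrA.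
  rewrite {1}/mix /= ltnSn [(b j w * _)%R]mulrC.
  congr (_ * (_ * _))%:E; apply: eq_bigr => i ij.
  rewrite /mix ltnS leq_eqVlt.
  by have /negbTE -> : (i : nat) != k by apply: contraNneq ij => ik; apply/eqP/val_inj.
exact: step.
Qed.

End integral_independent.

Section cell_integral.
Context d (T : measurableType d) (R : realType) (P : probability T R).
Variables (m : nat) (Z : 'I_m -> nat -> {RV P >-> R}).
Hypotheses (hindep : independent_sequences Z) (hiid : forall i, iid (Z i)).
Local Open Scope ereal_scope.

Lemma integral_iid i k (f : R -> \bar R) : (1 <= k)%N ->
  measurable_fun setT f -> (forall x, 0 <= f x) ->
  \int[P]_w f (Z i k w) = \int[P]_w f (Z i 1%N w).
Proof.
move=> k1 mf f0.
rewrite -[LHS](@ge0_integral_distribution _ _ _ _ _ P (Z i k))//.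
rewrite -[RHS](@ge0_integral_distribution _ _ _ _ _ P (Z i 1%N))//.
apply: eq_measure_integral => A mA _.
exact: (proj2 (hiid i) k k1 A mA).
Qed.

(** Freezing: the pair (U, S) depends on the other cells only, so Z^j_k can be integrated out with
    (U, S) held fixed, and then exchanged for Z^j_1, which has the same law. *)
Lemma integral_cell N j k (U S : T -> R) (f : R * R -> R) : (1 <= k <= N)%N ->
  measurable_wrt <<s cell_gen Z (other_cells N j k) >> U ->
  measurable_wrt <<s cell_gen Z (other_cells N j k) >> S ->
  (forall w, 0 <= U w)%R ->
  measurable_fun setT f -> (forall x, 0 <= f x)%R ->
  \int[P]_w (U w * f (S w, Z j k w))%:E =
  \int[P]_w ((U w)%:E * \int[P]_w' (f (S w, Z j 1%N w'))%:E).
Proof.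
move=> kN /measurable_wrtP mU /measurable_wrtP mS U0 mf f0.
have k1 : (1 <= k)%N by case/andP: kN.
(* The absolute value makes [F] nonnegative on the whole space, as Tonelli requires; it is harmless
   because U >= 0. *)
pose F (x : R * R * R) : \bar R := (`|x.1.1| * f (x.1.2, x.2))%:E.
have mf' s : measurable_fun setT (fun z => f (s, z)) by exact: measurableT_comp.
transitivity (\int[P]_w F ((U w, S w), Z j k w)).
  by apply: eq_integral => w _; rewrite /F /= ger0_norm.
rewrite (@integral_indep _ _ _ P (cell_gen Z (other_cells N j k)) _ _
  (fun w => (U w, S w)) (Z j k) F).
- apply: eq_integral => w _; rewrite /F /= ger0_norm//.
  under eq_integral do rewrite EFinM.
  rewrite ge0_integralZl//.
  + congr (_ * _); rewrite (@integral_iid j k (fun z => (f (S w, z))%:E))//.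
      exact/measurable_EFinP.
    by move=> x; rewrite lee_fin.
  + apply/measurable_EFinP.
    exact: (measurableT_comp (mf' (S w)) (measurable_funP (Z j k))).
  + by move=> w' _; rewrite lee_fin.
  + by rewrite lee_fin.
- exact: cell_gen_measurable.
- by apply/measurable_fun_pairP; split.
- by move=> A B sA mB; exact: (indep_cell hindep hiid kN).
- apply/measurable_EFinP/measurable_funM.
    apply: measurableT_comp => //; apply: measurableT_comp => //.
  apply: measurableT_comp => //; apply/measurable_fun_pairP; split.
    exact: (measurableT_comp measurable_snd measurable_fst).
  exact: measurable_snd.
- by move=> x; rewrite lee_fin mulr_ge0.
Qed.

End cell_integral.

(** * Conditional expectations *)

Section integral_aux.
Context d (T : measurableType d) (R : realType) (P : probability T R).
Local Open Scope ereal_scope.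

Lemma integral_indicM (B : set T) (f : T -> R) : measurable B ->
  \int[P]_w (\1_B w * f w)%:E = \int[P]_(w in B) (f w)%:E.
Proof.
move=> mB; rewrite [RHS]integral_mkcond; apply: eq_integral => w _.
by rewrite epatch_indic EFinM muleC.
Qed.

Lemma integrable_indicM (B : set T) (f : T -> R) : measurable B ->
  P.-integrable setT (EFin \o f) ->
  P.-integrable setT (fun w => (\1_B w * f w)%:E).
Proof.
move=> mB intf; rewrite (_ : (fun _ => _) = (EFin \o f) \_ B).
  by apply/integrable_restrict => //; rewrite setTI; exact: integrableS intf.
by apply/funext => w; rewrite epatch_indic EFinM muleC.
Qed.

Lemma ae_le_integral (f g : T -> R) :
  P.-integrable setT (EFin \o f) -> P.-integrable setT (EFin \o g) ->
  {ae P, forall w, (f w <= g w)%R} ->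
  \int[P]_w (f w)%:E <= \int[P]_w (g w)%:E.
Proof.
move=> intf intg fg.
have mf := (proj1 (measurable_EFinP _ _) (measurable_int _ intf)).
have mg := (proj1 (measurable_EFinP _ _) (measurable_int _ intg)).
(* [h] equals [g] almost surely and dominates [f] everywhere, so pointwise monotonicity applies to
   it. *)
pose h w := Num.max (f w) (g w).
have mh : measurable_fun setT h by exact: measurable_maxr.
have -> : \int[P]_w (g w)%:E = \int[P]_w (h w)%:E.
  apply: ae_eq_integral => //; [exact/measurable_EFinP|exact/measurable_EFinP|].
  by apply: filterS fg => w fg _; rewrite /h (max_idPr fg).
apply: le_integral => //; last by move=> w _; rewrite lee_fin le_max lexx.
apply: (@le_integrable _ _ _ _ _ _ _ (fun w => (`|f w| + `|g w|)%:E)) => //.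
- exact/measurable_EFinP.
- move=> w _; rewrite !abse_EFin lee_fin [X in (_ <= X)%R]ger0_norm ?addr_ge0//.
  by rewrite /h; case: (leP (f w) (g w)) => _; rewrite ?lerDl ?lerDr ?normr_ge0.
- under eq_fun do rewrite EFinD.
  by apply: integrableD => //; exact: integrable_norm.
Qed.

End integral_aux.

(** The set {Y < Y'} belongs to the sigma-algebra, so Y and Y' have the same integral over it; there
    Y' - Y > 0, hence the set is null. *)
Lemma is_condexp_le d (T : measurableType d) (R : realType)
    (P : probability T R) (G : set (set T)) (X Y Y' : T -> R) :
  G `<=` measurable ->
  is_condexp P <<s G >> X Y -> is_condexp P <<s G >> X Y' ->
  {ae P, forall w, Y' w <= Y w}.
Proof.
move=> Gm [/measurable_wrtP mY intY eqY] [/measurable_wrtP mY' intY' eqY'].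
pose A := [set w | Y w < Y' w].
have sA : <<s G >> A.
  have m1 : measurable [set true] by [].
  have := measurable_fun_ltr mY mY' measurableT m1.
  by rewrite setTI.
have mA : measurable A.
  exact: (smallest_sub (@sigma_algebra_measurable _ T) Gm sA).
pose f w := \1_A w * (Y' w - Y w).
have intf : P.-integrable setT (EFin \o f).
  apply: integrable_indicM => //.
  rewrite (_ : _ \o _ = ((EFin \o Y') \- (EFin \o Y))%E)//.
  exact: integrableB.
have f0 w : 0 <= f w.
  rewrite /f indicE; have [/set_mem Aw|_] := boolP (w \in A); last by rewrite mul0r.
  by rewrite mul1r subr_ge0 ltW.
have intf0 : (\int[P]_w `|(EFin \o f) w| = 0)%E.
  rewrite (eq_integral (fun w => (f w)%:E)); last first.
    by move=> w _; rewrite /= ger0_norm.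
  rewrite integral_indicM//; under eq_integral do rewrite EFinB.
  have iA g : P.-integrable setT (EFin \o g) -> P.-integrable A (EFin \o g).
    exact: integrableS.
  rewrite (integralB_EFin mA (iA _ intY') (iA _ intY)) eqY// eqY'// subee//.
  (* The integral of X over [A] is finite because it equals that of the integrable Y. *)
  by rewrite -eqY//; apply: integrable_fin_num => //; exact: iA.
have /ae_eq_integral_abs : measurable_fun setT (EFin \o f) by exact: measurable_int intf.
move=> /(_ P measurableT) [/(_ intf0) + _].
apply: filterS => w /(_ I) /= -[fw]; rewrite leNgt; apply/negP => lt.
move: fw; rewrite /f indicE mem_set// mul1r => /eqP.
by rewrite subr_eq0 gt_eqF.
Qed.

Lemma condexp_ae d (T : measurableType d) (R : realType)
    (P : probability T R) (G : set (set T)) (X Y : T -> R) :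
  G `<=` measurable -> is_condexp P <<s G >> X Y ->
  {ae P, forall w, condexp P <<s G >> X w = Y w}.
Proof.
move=> Gm YE.
have E : is_condexp P <<s G >> X (condexp P <<s G >> X).
  by apply: (@xgetPex _ (fun=> 0) [set Y | is_condexp P <<s G >> X Y]); exists Y.
apply: filterS2 (is_condexp_le Gm YE E) (is_condexp_le Gm E YE) => w h1 h2.
by apply/eqP; rewrite eq_le h1 h2.
Qed.

(** * Optimal stopping in the monotone case *)

Lemma limn_einfS (R : realType) (u : (\bar R)^nat) :
  limn_einf (fun n => u n.+1) = limn_einf u.
Proof.
rewrite !limn_einf_lim.
have es n : einfs (fun n => u n.+1) n = einfs u n.+1.
  congr ereal_inf; apply/seteqP; split=> x [k /= nk <-].
    by exists k.+1.
  by case: k nk => // k nk; exists k.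
have lE v : limn (einfs v) = ereal_sup (range (einfs v)).
  by apply/cvg_lim => //; exact: cvg_einfs_sup.
rewrite !lE.
apply/eqP; rewrite eq_le; apply/andP; split; apply: ge_ereal_sup => _ [n _ <-].
  by rewrite es; apply: ereal_sup_ubound; exists n.+1.
apply: (@le_trans _ _ (einfs u n.+1)).
  exact: (nondecreasing_einfs u (leqnSn n)).
by rewrite -es; apply: ereal_sup_ubound; exists n.
Qed.

Section monotone_case_stopping.
Context d (T : measurableType d) (R : realType) (P : probability T R).
Variables (G : nat -> set (set T)) (X Y : nat -> T -> R) (C : nat -> set T).
Hypothesis Gm : forall n, G n `<=` measurable.
Hypothesis Gnd : forall k n, (k <= n)%N -> <<s G k >> `<=` <<s G n >>.
Hypothesis intX : forall n, (1 <= n)%N -> P.-integrable setT (EFin \o X n).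
Hypothesis condY : forall n, (1 <= n)%N ->
  is_condexp P <<s G n >> (X n.+1) (Y n).
Hypothesis mC : forall n, (1 <= n)%N -> <<s G n >> (C n).
Hypothesis X_ge0 : {ae P, forall w, forall n, (1 <= n)%N -> 0 <= X n w}.
Hypothesis CE : {ae P, forall w, forall n, (1 <= n)%N -> C n w <-> Y n w <= X n w}.
Hypothesis Cnd : {ae P, forall w, forall n, (1 <= n)%N -> C n w -> C n.+1 w}.
Hypothesis X_cvg0 : (\int[P]_w (X n w)%:E)%E @[n --> \oo] --> 0%E.

Let A n := <<s G n >>.

Let Am n B : A n B -> measurable B.
Proof. exact: (smallest_sub (@sigma_algebra_measurable _ T) (@Gm n)). Qed.

(** For a stopping time this is {tau > n}, written as a finite intersection of complements of events
    that are in A_n. *)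
Definition beyond (tau : T -> option nat) n : set T :=
  [set w | forall k, (1 <= k <= n)%N -> tau w <> Some k].

(* X_(tau /\ (n+1)), the shift avoiding the meaningless [X 0] *)
Fixpoint frozen (tau : T -> option nat) n (w : T) : R :=
  if n is k.+1 then frozen tau k w + \1_(beyond tau n) w * (X n.+1 w - X n w)
  else X 1%N w.

Lemma beyond_sigma tau n : is_stopping_time A tau -> (1 <= n)%N ->
  A n (beyond tau n).
Proof.
move=> [_ st] n1.
have -> : beyond tau n =
    \bigcap_(k in [set k | (1 <= k <= n)%N]) ~` [set w | tau w = Some k] by [].
apply: (@fin_bigcap_measurable _ (g_sigma_algebraType (G n))) => /=.
  by apply: (@sub_finite_set _ _ `I_n.+1) => // k /= /andP[_]; rewrite ltnS.
move=> k /andP[k1 kn].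
apply: (@measurableC _ (g_sigma_algebraType (G n))).
exact: (Gnd kn (st k k1)).
Qed.

(** The increments telescope. The recursive form serves the integrals of increments, this closed
    form the pointwise limits and bounds. *)
Lemma frozenE tau n w : tau w <> Some 0%N ->
  frozen tau n w = if tau w is Some k then X (minn k n.+1) w else X n.+1 w.
Proof.
move=> t0; elim: n => [|n ih].
  by case: (tau w) t0 => //= -[//|k] _; rewrite minnSS minn0.
rewrite /= {}ih indicE; case tw : (tau w) t0 => [k|] t0.
  have k0 : (0 < k)%N by case: k t0 {tw} => //.
  case: (leqP k n.+1) => kn.
    rewrite memNset; last by move/(_ k); rewrite kn k0 => /(_ isT).
    by rewrite mul0r addr0 (minn_idPl (leqW kn)).
  rewrite mem_set ?mul1r; first by rewrite (minn_idPr kn) addrC subrK.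
  by move=> j /andP[_ jn]; rewrite tw => -[kj]; move: kn; rewrite kj ltnNge jn.
rewrite mem_set ?mul1r; first by rewrite addrC subrK.
by move=> j _; rewrite tw.
Qed.

Lemma stopped_frozen tau w : tau w <> Some 0%N ->
  stopped X tau w = limn_einf (fun n => (frozen tau n w)%:E).
Proof.
move=> t0; rewrite /stopped.
have -> : (fun n => (frozen tau n w)%:E) = (fun n =>
    (if tau w is Some k then X (minn k n.+1) w else X n.+1 w)%:E).
  by apply/funext => n; rewrite frozenE.
case tw : (tau w) t0 => [k|] _; last first.
  by rewrite (limn_einfS (fun n => (X n w)%:E)).
have cv : (X (minn k n.+1) w)%:E @[n --> \oo] --> (X k w)%:E.
  apply: cvg_near_cst; near=> n; apply/eqP; rewrite (minn_idPl _)//.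
  by near: n; exists k => // n /= /leqW.
rewrite is_cvg_limn_einfE; first by apply/esym/cvg_lim.
by apply/cvg_ex; exists (X k w)%:E.
Unshelve. all: by end_near. Qed.

Lemma integrable_frozen tau n : is_stopping_time A tau ->
  P.-integrable setT (EFin \o frozen tau n).
Proof.
move=> st; elim: n => [|n ih]; first exact: intX.
rewrite /= (_ : _ \o _ = ((EFin \o frozen tau n) \+
  (fun w => (\1_(beyond tau n.+1) w * (X n.+2 w - X n.+1 w))%R%:E))%E)//.
apply: integrableD => //; apply: integrable_indicM.
  exact: (Am (beyond_sigma st _)).
rewrite (_ : _ \o _ = ((EFin \o X n.+2) \- (EFin \o X n.+1))%E)//.
by apply: integrableB => //; exact: intX.
Qed.

Lemma measurable_stopped tau : is_stopping_time A tau ->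
  measurable_fun setT (stopped X tau).
Proof.
move=> st.
have -> : stopped X tau =
    fun w => (- limn_esup (fun n => - (frozen tau n w)%:E))%E.
  by apply/funext => w; rewrite stopped_frozen//; exact: (proj1 st w).
apply: measurableT_comp => //.
apply: measurable_fun_limn_esup => n; apply: measurableT_comp => //.
exact: measurable_int (integrable_frozen n st).
Qed.

(** Since the decision [B] to continue is known at time n, X_(n+1) may be replaced by its
    conditional expectation. *)
Lemma integral_increment n B : (1 <= n)%N -> A n B ->
  (\int[P]_w (\1_B w * (X n.+1 w - X n w))%:E =
   \int[P]_w (\1_B w * (Y n w - X n w))%:E)%E.
Proof.
move=> n1 AB; have mB := Am AB; have [_ intY eqY] := condY n1.
rewrite !integral_indicM//.
have iX k : (1 <= k)%N -> P.-integrable B (EFin \o X k).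
  by move=> k1; apply: integrableS (intX k1).
have iY : P.-integrable B (EFin \o Y n) by apply: integrableS intY.
under eq_integral do rewrite EFinB.
under [RHS]eq_integral do rewrite EFinB.
rewrite (integralB_EFin mB (iX n.+1 isT) (iX n n1)).
rewrite (integralB_EFin mB iY (iX n n1)).
by rewrite eqY.
Qed.

(** Defined from [C] rather than from {Y n <= X n}, so that it can be instantiated to [tau_star] at
    every point and not only almost surely. *)
Let tau1 (w : T) : option nat := inf_time [set k | (1 <= k)%N /\ C k w].

Lemma inf_time_someP (D : set nat) n : inf_time D = Some n <->
  D n /\ forall k, D k -> (n <= k)%N.
Proof.
rewrite /inf_time; case: pselect => [h|h]; last first.
  by split=> // -[Dn _]; exfalso; apply: h; exists n; exact/asboolP.
split=> [[<-]|[Dn ub]].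
  by case: ex_minnP => k /asboolP Dk ub; split=> // j Dj; apply/ub/asboolP.
congr Some; case: ex_minnP => k /asboolP Dk ub'.
by apply/eqP; rewrite eqn_leq ub ?andbT//; apply/ub'/asboolP.
Qed.

Lemma stopping_time_inf : is_stopping_time A tau1.
Proof.
split=> [w /inf_time_someP[[]]//|n n1].
have -> : [set w | tau1 w = Some n] =
    C n `&` \bigcap_(k in [set k | (1 <= k < n)%N]) ~` C k.
  apply/seteqP; split=> [w /inf_time_someP[[_ Cn] ub]|w [Cn h]].
    split=> // k /= /andP[k1 kn] Ck.
    by have := ub k (conj k1 Ck); rewrite leqNgt kn.
  apply/inf_time_someP; split=> // k [k1 Ck]; rewrite leqNgt; apply/negP => kn.
  by apply: (h k) => //=; rewrite k1.
apply: (@measurableI _ (g_sigma_algebraType (G n))); first exact: mC.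
apply: (@fin_bigcap_measurable _ (g_sigma_algebraType (G n))) => /=.
  by apply: (@sub_finite_set _ _ `I_n) => // k /= /andP[].
move=> k /andP[k1 kn]; apply: (@measurableC _ (g_sigma_algebraType (G n))).
exact: (Gnd (ltnW kn) (mC k1)).
Qed.

Lemma beyond_inf n w : beyond tau1 n w <->
  forall k, (1 <= k <= n)%N -> ~ C k w.
Proof.
split=> [h k /andP[k1 kn] Ck|h k /andP[k1 kn] /inf_time_someP[[_ Ck] _]].
  have ex : exists j, `[< (1 <= j)%N /\ C j w >] by exists k; exact/asboolP.
  case: (ex_minnP ex) => j /asboolP[j1 Cj] ub.
  apply: (h j).
    by rewrite j1 (leq_trans _ kn)//; apply/ub/asboolP.
  by apply/inf_time_someP; split=> // l Dl; exact/ub/asboolP.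
by apply: (h k) => //; rewrite k1.
Qed.

(* On [tau1 > n] the conditional increment [Y n - X n] is positive and off it
   nonpositive, so no other set of continuation collects more of it. *)
Lemma le_integral_frozen tau n : is_stopping_time A tau ->
  (\int[P]_w (frozen tau n w)%:E <= \int[P]_w (frozen tau1 n w)%:E)%E.
Proof.
move=> st; have st1 := stopping_time_inf.
elim: n => [|n ih]; first exact: lexx.
pose D sigma (w : T) := \1_(beyond sigma n.+1) w * (X n.+2 w - X n.+1 w).
pose D' sigma (w : T) := \1_(beyond sigma n.+1) w * (Y n.+1 w - X n.+1 w).
have [_ intY _] := condY (ltn0Sn n).
have intD sigma : is_stopping_time A sigma -> P.-integrable setT (EFin \o D sigma).
  move=> ss; apply: integrable_indicM; first exact: (Am (beyond_sigma ss _)).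
  rewrite (_ : _ \o _ = ((EFin \o X n.+2) \- (EFin \o X n.+1))%E)//.
  by apply: integrableB => //; exact: intX.
have intD' sigma : is_stopping_time A sigma -> P.-integrable setT (EFin \o D' sigma).
  move=> ss; apply: integrable_indicM; first exact: (Am (beyond_sigma ss _)).
  rewrite (_ : _ \o _ = ((EFin \o Y n.+1) \- (EFin \o X n.+1))%E)//.
  by apply: integrableB => //; exact: intX.
have split_int sigma : is_stopping_time A sigma ->
    (\int[P]_w (frozen sigma n.+1 w)%:E =
     \int[P]_w (frozen sigma n w)%:E + \int[P]_w (D' sigma w)%:E)%E.
  move=> ss; rewrite -integral_increment//; last exact: beyond_sigma.
  rewrite -(@integralD_EFin _ _ _ P setT measurableT (frozen sigma n) (D sigma))//.
    exact: integrable_frozen.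
  exact: intD.
rewrite !split_int//; apply: leeD => //.
apply: ae_le_integral; [exact: intD'|exact: intD'|].
apply: filterS2 CE Cnd => w wCE wCnd.
have Cmono j : (1 <= j)%N -> C j w -> forall l, (j <= l)%N -> C l w.
  move=> j1 Cj; elim=> [|l ihl]; first by rewrite leqNgt j1.
  rewrite leq_eqVlt => /predU1P[<-//|]; rewrite ltnS => jl.
  by apply: wCnd; [exact: leq_trans j1 jl|exact: ihl].
rewrite /D' !indicE.
have [b1|nb1] := pselect (beyond tau1 n.+1 w).
  rewrite (mem_set b1) mul1r; case: (_ \in _); rewrite ?mul1r// mul0r subr_ge0.
  have nC : ~ C n.+1 w by apply: ((beyond_inf n.+1 w).1 b1); rewrite leqnn.
  by rewrite leNgt; apply/negP => /ltW /(wCE _ (ltn0Sn n)).2.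
(* Here the monotone case enters: some [C k] with k <= n+1 holds, so [C n.+1] holds too and the
   conditional increment is at most 0. *)
rewrite (memNset nb1) mul0r; case: (_ \in _); rewrite ?mul1r ?mul0r// subr_le0.
apply/(wCE _ (ltn0Sn n)).1; apply: contrapT => nC; apply: nb1.
apply/beyond_inf => k /andP[k1 kn] Ck; apply: nC; exact: Cmono Ck _ kn.
Qed.

Lemma frozen_ge0 tau : is_stopping_time A tau ->
  {ae P, forall w, forall n, 0 <= frozen tau n w}.
Proof.
move=> st; apply: filterS X_ge0 => w X0 n; rewrite frozenE; last exact: (proj1 st).
have := proj1 st w; case: (tau w) => [[//|k]|] _; last exact: X0.
by apply: X0; rewrite leq_min.
Qed.

Lemma stopped_ge0 tau : is_stopping_time A tau ->
  {ae P, forall w, 0 <= stopped X tau w}%E.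
Proof.
move=> st; apply: filterS (frozen_ge0 st) => w f0.
rewrite stopped_frozen; last exact: (proj1 st).
rewrite limn_einf_lim; apply: lime_ge; first exact: is_cvg_einfs.
by apply: nearW => n; apply: le_ereal_inf_tmp => _ [k _ <-]; rewrite lee_fin.
Qed.

Lemma expectation_stopped tau : is_stopping_time A tau ->
  expectation_exists P (stopped X tau).
Proof.
move=> st; right; have ms := measurable_stopped st.
rewrite (_ : \int[P]_w _ = 0)%E ?ltry//.
rewrite -[RHS](integral0 P setT); apply: ae_eq_integral => //.
  exact: measurable_funeneg.
apply: filterS (stopped_ge0 st) => w s0 _.
by rewrite funenegE; apply/max_idPr; rewrite leeNl oppe0.
Qed.

(** Absolute values turn almost sure nonnegativity into pointwise nonnegativity, which Fatou's lemma
    and the additivity of nonnegative integrals require. *)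
Lemma integral_stopped_abs tau : is_stopping_time A tau ->
  (\int[P]_w stopped X tau w = \int[P]_w `|stopped X tau w|)%E.
Proof.
move=> st; have ms := measurable_stopped st.
apply: ae_eq_integral => //; first exact: measurableT_comp.
by apply: filterS (stopped_ge0 st) => w s0 _; rewrite gee0_abs.
Qed.

Lemma integral_frozen_abs tau n : is_stopping_time A tau ->
  (\int[P]_w `|frozen tau n w|%:E = \int[P]_w (frozen tau n w)%:E)%E.
Proof.
move=> st; have mf := measurable_int _ (integrable_frozen n st).
apply: ae_eq_integral => //.
  by apply/measurable_EFinP/measurableT_comp => //; apply/measurable_EFinP.
by apply: filterS (frozen_ge0 st) => w /(_ n) s0 _; rewrite ger0_norm.
Qed.

Lemma integral_frozen_le n :
  (\int[P]_w (frozen tau1 n w)%:E <=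
   \int[P]_w stopped X tau1 w + \int[P]_w (X n.+1 w)%:E)%E.
Proof.
have st := stopping_time_inf; have ms := measurable_stopped st.
have mX : measurable_fun setT (X n.+1).
  exact/measurable_EFinP/(measurable_int _ (intX _)).
have -> : (\int[P]_w (X n.+1 w)%:E = \int[P]_w `|X n.+1 w|%:E)%E.
  apply: ae_eq_integral => //.
  - exact/measurable_EFinP.
  - exact/measurable_EFinP/measurableT_comp.
  - by apply: filterS X_ge0 => w X0 _; rewrite ger0_norm// X0.
rewrite integral_stopped_abs// -integral_frozen_abs//.
rewrite -ge0_integralD//; last 2 first.
- exact: measurableT_comp.
- exact/measurable_EFinP/measurableT_comp.
apply: ge0_le_integral => //.
- apply/measurable_EFinP/measurableT_comp => //.
  exact/measurable_EFinP/(measurable_int _ (integrable_frozen n st)).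
- apply: emeasurable_funD; first exact: measurableT_comp.
  exact/measurable_EFinP/measurableT_comp.
move=> w _; rewrite frozenE; last exact: (proj1 st).
rewrite /stopped; case: (tau1 w) => [k|]; last by rewrite leeDr// abse_ge0.
by rewrite /minn; case: ifP => _; rewrite -EFinD lee_fin ?lerDl ?lerDr.
Qed.

Lemma optimal_inf_time : optimal_stopping_time P A X tau1.
Proof.
have st1 := stopping_time_inf; split => //; first exact: expectation_stopped.
apply/eqP; rewrite eq_le; apply/andP; split.
  apply: ereal_sup_ubound; exists tau1 => //; split => //.
  exact: expectation_stopped.
apply: ge_ereal_sup => _ [tau [st _] <-].
have mf n := measurable_int _ (integrable_frozen n st).
have -> : (\int[P]_w stopped X tau w =
    \int[P]_w limn_einf (fun n => `|frozen tau n w|%:E))%E.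
  apply: ae_eq_integral => //; first exact: measurable_stopped.
    apply: measurableT_comp => //; apply: measurable_fun_limn_esup => n.
    apply: measurableT_comp => //.
    by apply/measurable_EFinP/measurableT_comp => //; apply/measurable_EFinP.
  apply: filterS (frozen_ge0 st) => w f0 _.
  rewrite stopped_frozen; last exact: (proj1 st).
  by congr limn_einf; apply/funext => n; rewrite ger0_norm.
apply: (le_trans (fatou _ _ _ _)) => //.
  move=> n; apply/measurable_EFinP/measurableT_comp => //.
  by apply/measurable_EFinP.
set c := (\int[P]_w stopped X tau1 w)%E.
have c0 : (0 <= c)%E.
  by rewrite /c integral_stopped_abs//; exact: integral_ge0.
(* The value [c] is not known to be finite here; [c0] makes the sum well defined in the limit. *)
have cv : (c + \int[P]_w (X n.+1 w)%:E)%E @[n --> \oo] --> c.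
  rewrite -[X in _ --> X]adde0; apply: cvgeD.
  - by rewrite ge0_adde_def// inE.
  - exact: cvg_cst.
  - by rewrite (@cvg_shiftS _ (fun n => \int[P]_w (X n w)%:E)%E).
have <- : limn_einf (fun n => c + \int[P]_w (X n.+1 w)%:E)%E = c.
  rewrite is_cvg_limn_einfE; first exact/cvg_lim.
  by apply/cvg_ex; exists c.
rewrite !limn_einf_lim; apply: lee_lim; [exact: is_cvg_einfs|exact: is_cvg_einfs|].
apply: nearW => n; apply: le_ereal_inf_tmp => _ [k /= nk <-].
apply: le_trans (integral_frozen_le k).
apply: (le_trans _ (le_integral_frozen k st)).
rewrite -integral_frozen_abs//.
by apply: ereal_inf_lbound; exists k.
Qed.

End monotone_case_stopping.

(** * Products of discounted maxima *)

(** The part of [I] where f >= r is an interval, and rays [r, +oo[ generate the Borel sets. *)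
Lemma measurable_nonincreasing_itv (R : realType) (I : interval R) (f : R -> R) :
  (forall s t, s \in I -> t \in I -> s <= t -> f t <= f s) ->
  measurable_fun [set` I] f.
Proof.
move=> f_ni; apply: (measurability (@RGenCInfty.G R)) => [|/= _ [_] [r] -> <-].
  exact: RGenCInfty.measurableE.
apply: is_interval_measurable => s t /= [sI fs] [tI ft] u /andP[su ut].
have uI : u \in I by apply: (@interval_is_interval _ I s t sI tI u); rewrite su ut.
split=> //; move: ft; rewrite !in_itv/= !andbT => ft.
by apply: (le_trans ft); exact: f_ni.
Qed.

Section running_max.
Context d (T : measurableType d) (R : realType) (P : probability T R).
Variables (m : nat) (Z : 'I_m -> nat -> {RV P >-> R}).

(** For n >= 1 the default element Z^i_1 of the big maximum is one of its terms. *)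
Lemma running_max_le i n w (c : R) : (1 <= n)%N ->
  reflect (forall k, (1 <= k <= n)%N -> Z i k w <= c) (running_max Z i n w <= c).
Proof.
move=> n1; apply: (iffP idP) => [le k kn|h].
  apply: le_trans le; rewrite /running_max.
  apply: (le_bigmax_seq (Z i 1%N w) k xpredT (fun k => Z i k w)) => //.
  by rewrite mem_index_iota ltnS.
rewrite /running_max big_seq; apply: bigmax_le => [|k]; first exact: h.
by rewrite mem_index_iota ltnS; exact: h.
Qed.

Lemma running_maxS i n w : (1 <= n)%N ->
  running_max Z i n.+1 w = Num.max (running_max Z i n w) (Z i n.+1 w).
Proof.
move=> n1; apply/eqP; rewrite eq_le; apply/andP; split.
  apply/running_max_le => // k /andP[k1]; rewrite leq_eqVlt => /predU1P[->|].
    by rewrite le_max lexx orbT.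
  rewrite ltnS => kn; rewrite le_max; apply/orP; left.
  by apply: (running_max_le _ _ _ n1 _); rewrite ?lexx ?k1.
have /(running_max_le i w _ (ltn0Sn n)) h := lexx (running_max Z i n.+1 w).
rewrite ge_max h ?leqnn// andbT.
by apply/running_max_le => // k /andP[k1 kn]; apply: h; rewrite k1 leqW.
Qed.

Lemma running_max_ge i n k w : (1 <= k <= n)%N -> Z i k w <= running_max Z i n w.
Proof.
move=> /[dup] /andP[k1 kn] h.
by apply: (running_max_le i w _ (leq_trans k1 kn) _).
Qed.

Lemma measurable_running_max i n (D : set ('I_m * nat)) : (1 <= n)%N ->
  (forall k, (1 <= k <= n)%N -> D (i, k)) ->
  measurable_wrt <<s cell_gen Z D >> (running_max Z i n).
Proof.
have mZ k : D (i, k) -> measurable_wrt <<s cell_gen Z D >> (Z i k).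
  by move=> Dk _ [B mB <-]; apply: sub_sigma_algebra; exists (i, k) => //; exists B.
case: n => // n _; elim: n => [|n ih] hD.
  have -> : running_max Z i 1 = Z i 1%N.
    by apply/funext => w; rewrite /running_max /index_iota big_cons big_nil maxxx.
  by apply: mZ; exact: hD.
have -> : running_max Z i n.+2 =
    fun w => Num.max (running_max Z i n.+1 w) (Z i n.+2 w).
  by apply/funext => w; rewrite running_maxS.
apply/measurable_wrtP/measurable_maxr; apply/measurable_wrtP.
  by apply: ih => k /andP[k1 kn]; apply: hD; rewrite k1 leqW.
by apply: mZ; apply: hD; rewrite leqnn.
Qed.

Lemma rewardE rho n w :
  reward rho Z n w = (rho ^+ n) ^+ m * \prod_(i < m) running_max Z i n w.
Proof.
by rewrite /reward /discounted_max big_split/= prodr_const card_ord.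
Qed.

End running_max.

Section product_problem.
Context d (T : measurableType d) (R : realType) (P : probability T R).
Variables (m : nat) (rho : R) (Z : 'I_m -> nat -> {RV P >-> R}).
Hypothesis hrho : 0 < rho < 1.
Hypotheses (hindep : independent_sequences Z) (hiid : forall i, iid (Z i)).
Hypothesis hint : forall (i : 'I_m) (n : nat), (1 <= n)%N ->
  P.-integrable setT (EFin \o Z i n).
Hypothesis hpos : forall (i : 'I_m) (n : nat), (1 <= n)%N ->
  {ae P, forall w, 0 < Z i n w}.

Local Notation S := (running_max Z).

Let rho_gt0 : 0 < rho. Proof. by case/andP: hrho. Qed.

Lemma ae_pos : {ae P, forall w, forall i k, (1 <= k)%N -> 0 < Z i k w}.
Proof.
suff : {ae P, forall w, forall (k : nat) (i : 'I_m), 0 < Z i k.+1 w}.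
  by apply: filterS => w h i [//|k] _.
apply: ae_foralln => k.
(* The finite index is coded as a natural number, so that the countable intersection of almost sure
   events covers it. *)
have : {ae P, forall w, forall j, if insub j is Some i then 0 < Z (i : 'I_m) k.+1 w else true}.
  apply: ae_foralln => j; case: insubP => [i _ _|_]; first exact: hpos.
  exact: aeW.
by apply: filterS => w h i; have := h i; rewrite valK.
Qed.

Lemma running_max_gt0 i n w : (forall i k, (1 <= k)%N -> 0 < Z i k w) ->
  (1 <= n)%N -> 0 < S i n w.
Proof.
by move=> Z0 n1; apply: (lt_le_trans (Z0 i 1%N isT)); exact: running_max_ge.
Qed.

(* Truncated at 0, so that the integrands below are nonnegative everywhere and
   not only almost surely. *)
Definition posmax (x : R * R) : R := Num.max (Num.max x.1 x.2) 0.

(** This is s g_i(s) for s > 0. At s = 0 it is E Z^i_1, the constant in the bound of E X_n. *)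
Definition maxmean (i : 'I_m) (s : R) : R :=
  fine (\int[P]_w (posmax (s, Z i 1%N w))%:E)%E.

Lemma posmax_ge0 x : 0 <= posmax x.
Proof. by rewrite le_max lexx orbT. Qed.

Lemma measurable_posmax : measurable_fun [set: R * R] posmax.
Proof.
apply: measurable_maxr => //; apply: measurable_maxr.
  exact: measurable_fst.
exact: measurable_snd.
Qed.

Lemma integrable_posmax i s :
  P.-integrable setT (fun w => (posmax (s, Z i 1%N w))%:E).
Proof.
have mZ : measurable_fun setT (Z i 1%N) by exact: measurable_funP.
apply: (@le_integrable _ _ _ _ _ _ _ (fun w => (`|s| + `|Z i 1%N w|)%:E)) => //.
- apply/measurable_EFinP; apply: measurable_maxr => //.
  exact: measurable_maxr.
- move=> w _; rewrite !abse_EFin lee_fin (ger0_norm (posmax_ge0 _)).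
  rewrite [X in _ <= X]ger0_norm ?addr_ge0//.
  rewrite /posmax /= !ge_max addr_ge0// andbT; apply/andP; split.
    by rewrite (le_trans (ler_norm _))// lerDl.
  by rewrite (le_trans (ler_norm _))// lerDr.
- under eq_fun do rewrite EFinD.
  apply: integrableD => //; first exact: finite_measure_integrable_cst.
  by apply: integrable_norm; exact: hint.
Qed.

Lemma maxmeanE i s : (maxmean i s)%:E = (\int[P]_w (posmax (s, Z i 1%N w))%:E)%E.
Proof. by rewrite fineK//; apply: integrable_fin_num => //; exact: integrable_posmax. Qed.

Lemma maxmean_ge0 i s : 0 <= maxmean i s.
Proof.
by apply/fine_ge0/integral_ge0 => w _; rewrite lee_fin posmax_ge0.
Qed.

Lemma measurable_maxmean i : measurable_fun setT (maxmean i).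
Proof.
have mf : measurable_fun [set: R * T] (fun x : R * T => (posmax (x.1, Z i 1%N x.2))%:E).
  apply/measurable_EFinP; apply: (measurableT_comp measurable_posmax).
  apply/measurable_fun_pairP; split; first exact: measurable_fst.
  exact: (measurableT_comp (measurable_funP (Z i 1%N)) measurable_snd).
have f0 (x : R * T) : (0 <= (posmax (x.1, Z i 1%N x.2))%:E)%E.
  by rewrite lee_fin posmax_ge0.
have mF := measurable_fun_fubini_tonelli_F (m2 := P) _ mf f0.
exact: (measurableT_comp (@fine_measurable R setT measurableT) mF).
Qed.

Lemma integrable_ratio i s :
  P.-integrable setT (fun w => (Num.max 1 (Z i 1%N w / s))%:E).
Proof.
have mZ : measurable_fun setT (fun w => Z i 1%N w / s).
  by apply: measurable_funM => //; exact: measurable_funP.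
apply: (@le_integrable _ _ _ _ _ _ _ (fun w => (1 + `|Z i 1%N w / s|)%:E)) => //.
- by apply/measurable_EFinP; exact: measurable_maxr.
- move=> w _; rewrite !abse_EFin lee_fin.
  rewrite [X in X <= _]ger0_norm ?le_max ?ler01//.
  rewrite [X in _ <= X]ger0_norm ?addr_ge0// ge_max lerDl normr_ge0/=.
  by rewrite (le_trans (ler_norm _))// lerDr.
- under eq_fun do rewrite EFinD.
  apply: integrableD => //; first exact: finite_measure_integrable_cst.
  apply: integrable_norm => //; rewrite (_ : _ \o _ =
    ((EFin \o Z i 1%N) \* cst (s^-1)%:E)%E)//.
  by apply: integrableZr => //; exact: hint.
Qed.

Lemma gfunE i s :
  (gfun Z i s)%:E = (\int[P]_w (Num.max 1 (Z i 1%N w / s))%:E)%E.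
Proof.
rewrite /gfun expectation.unlock fineK//.
by apply: integrable_fin_num => //; exact: integrable_ratio.
Qed.

(** Factor s out of max(s, Z); the truncation at 0 is inactive because s > 0. *)
Lemma gfun_maxmean i s : 0 < s -> maxmean i s = s * gfun Z i s.
Proof.
move=> s0.
have eqi : {ae P, forall w, posmax (s, Z i 1%N w) = s * Num.max 1 (Z i 1%N w / s)}.
  apply: filterS (@hpos i 1%N isT) => w Z0.
  rewrite maxr_pMr ?ltW// mulr1 mulrCA divff ?gt_eqF// mulr1.
  by apply/max_idPl; rewrite le_max (ltW s0).
have mg := measurable_int _ (integrable_ratio i s).
apply: EFin_inj; rewrite EFinM maxmeanE gfunE -ge0_integralZl_EFin ?ltW//.
- apply: ae_eq_integral => //.
  + exact: measurable_int (integrable_posmax i s).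
  + exact: measurable_funeM.
  + by apply: filterS eqi => w -> _; rewrite EFinM.
- by move=> w _; rewrite lee_fin le_max ler01.
Qed.

Lemma gfun_ge1 i s : 1 <= gfun Z i s.
Proof.
rewrite -lee_fin gfunE.
rewrite [leLHS](_ : _ = \int[P]_w (1%:E : \bar R))%E; last first.
  by rewrite integral_cst//= probability_setT mule1.
apply: le_integral => //; first exact: finite_measure_integrable_cst.
  exact: integrable_ratio.
by move=> w _; rewrite lee_fin le_max lexx.
Qed.

(** Then Z/s <= 0 almost surely, with 1/0 = 0 at s = 0. Together with monotonicity on the positive
    reals this makes g_i measurable on the whole line. *)
Lemma gfun_le0 i s : s <= 0 -> gfun Z i s = 1.
Proof.
move=> s0; apply: EFin_inj; rewrite gfunE.
rewrite [RHS](_ : _ = \int[P]_w (1%:E : \bar R))%E; last first.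
  by rewrite integral_cst//= probability_setT mule1.
apply: ae_eq_integral => //; first exact: measurable_int (integrable_ratio i s).
apply: filterS (@hpos i 1%N isT) => w Z0 _; congr EFin; apply/max_idPl.
by rewrite (le_trans _ ler01)// mulr_ge0_le0 ?invr_le0// ltW.
Qed.

Lemma gfun_anti i s t : 0 < s -> s <= t -> gfun Z i t <= gfun Z i s.
Proof.
move=> s0 st; rewrite -lee_fin !gfunE.
rewrite -lee_fin in st.
apply: ae_le_integral; [exact: integrable_ratio|exact: integrable_ratio|].
apply: filterS (@hpos i 1%N isT) => w Z0.
rewrite ge_max !le_max lexx/=; apply/orP; right.
by rewrite ler_pM2l// lef_pV2// ?posrE// (lt_le_trans s0).
Qed.

Lemma measurable_gfun i : measurable_fun setT (gfun Z i).
Proof.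
have -> : gfun Z i = fun s => if 0 < s then gfun Z i s else 1.
  by apply/funext => s; case: ltP => // s0; rewrite gfun_le0.
apply: measurable_fun_if => //.
- exact: measurable_fun_ltr.
- rewrite setTI (_ : _ @^-1` _ = `]0, +oo[%classic).
    apply: measurable_nonincreasing_itv => s t; rewrite in_itv/= andbT.
    by move=> s0 _; exact: gfun_anti.
  by apply/seteqP; split=> s /=; rewrite in_itv/= andbT.
Qed.

(** * Conditional expectation of the next reward, and bounds on the expected reward *)

Lemma measurable_running_max_grid i n : (1 <= n)%N ->
  measurable_wrt <<s cell_gen Z (grid m n) >> (S i n).
Proof. by move=> n1; apply: measurable_running_max. Qed.

Lemma grid_other_cells n j : grid m n `<=` other_cells n.+1 j n.+1.
Proof.
move=> [i k] /= /andP[k1 kn]; split; first by rewrite k1 leqW.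
by rewrite xpair_eqE negb_and orbC ltn_eqF.
Qed.

Lemma measurable_wrtS (F F' : set (set T)) (V : T -> R) :
  F `<=` F' -> measurable_wrt F V -> measurable_wrt F' V.
Proof. by move=> FF' mV A /mV /FF'. Qed.

Lemma measurable_wrt_measurable (D : set ('I_m * nat)) (V : T -> R) :
  measurable_wrt <<s cell_gen Z D >> V -> measurable_fun setT V.
Proof.
move=> /measurable_wrtP; apply: measurable_fun_sub_sigma.
exact: cell_gen_measurable.
Qed.

Lemma integral_next_max n (U : T -> R) : (1 <= n)%N -> (forall w, 0 <= U w) ->
  measurable_wrt <<s cell_gen Z (grid m n) >> U ->
  (\int[P]_w (U w * \prod_(i < m) posmax (S i n w, Z i n.+1 w))%:E =
   \int[P]_w (U w * \prod_(i < m) maxmean i (S i n w))%:E)%E.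
Proof.
move=> n1 U0 mU.
(* [F j] omits only the cell (j, n+1): it carries the past up to time n and the other new variables,
   hence all factors that act as weights when Z^j_(n+1) is integrated out. *)
pose F j := cell_gen Z (other_cells n.+1 j n.+1).
have sub j : <<s cell_gen Z (grid m n) >> `<=` <<s F j >>.
  by apply: sub_cell_gen; exact: grid_other_cells.
have mUF j : measurable_wrt <<s F j >> U by exact: (measurable_wrtS (sub j) mU).
have mS i j : measurable_wrt <<s F j >> (S i n).
  exact: (measurable_wrtS (sub j) (measurable_running_max_grid n1)).
have mZ i j : i != j -> measurable_wrt <<s F j >> (Z i n.+1).
  move=> ij _ [B mB <-]; apply: sub_sigma_algebra; exists (i, n.+1).
    by split=> /=; [rewrite leqnn|rewrite xpair_eqE negb_and ij].
  by exists B.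
have ma i j : i != j ->
    measurable_wrt <<s F j >> (fun w => posmax (S i n w, Z i n.+1 w)).
  move=> ij; apply/measurable_wrtP; apply: measurable_maxr => //.
  apply: measurable_maxr; apply/measurable_wrtP; first exact: mS.
  exact: mZ.
have mb i j : i != j -> measurable_wrt <<s F j >> (fun w => maxmean i (S i n w)).
  move=> ij; apply/measurable_wrtP; apply: measurableT_comp.
    exact: measurable_maxmean.
  exact/measurable_wrtP.
have step j V : (forall w, 0 <= V w) -> measurable_wrt <<s F j >> V ->
    (\int[P]_w (V w * posmax (S j n w, Z j n.+1 w))%:E =
     \int[P]_w (V w * maxmean j (S j n w))%:E)%E.
  move=> V0 mV; have nn : (1 <= n.+1 <= n.+1)%N by rewrite leqnn.
  rewrite (integral_cell hindep hiid nn mV (mS j j) V0 measurable_posmax posmax_ge0).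
  by apply: eq_integral => w _; rewrite EFinM maxmeanE.
(* Replacement yields an inequality; as each step is an equality, it applies in both directions. *)
apply/eqP; rewrite eq_le; apply/andP; split;
  apply: (integral_prod_replace (G := F)) => //.
- by move=> i w; exact: posmax_ge0.
- by move=> i w; exact: maxmean_ge0.
- by move=> j V V0 mV; rewrite step.
- by move=> i w; exact: maxmean_ge0.
- by move=> i w; exact: posmax_ge0.
- by move=> j V V0 mV; rewrite step.
Qed.

(** A version of E(X_(n+1) | A_n), stated with [maxmean] instead of g_i so that it is nonnegative
    everywhere. *)
Definition continuation n (w : T) : R :=
  (rho ^+ n.+1) ^+ m * \prod_(i < m) maxmean i (S i n w).

Lemma measurable_continuation n : (1 <= n)%N ->
  measurable_wrt <<s cell_gen Z (grid m n) >> (continuation n).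
Proof.
move=> n1; apply/measurable_wrtP; apply: measurable_funM => //.
apply: measurable_prod => i _; apply: measurableT_comp.
  exact: measurable_maxmean.
by apply/measurable_wrtP; exact: measurable_running_max_grid.
Qed.

Lemma measurable_reward n : (1 <= n)%N ->
  measurable_wrt <<s cell_gen Z (grid m n) >> (reward rho Z n).
Proof.
move=> n1; apply/measurable_wrtP; apply: measurable_prod => i _.
apply: measurable_funM => //; apply/measurable_wrtP.
exact: measurable_running_max_grid.
Qed.

Lemma posmax_sum_ge i n w : (1 <= n)%N ->
  Num.max (S i n w) 0 <= \sum_(1 <= k < n.+1) posmax (0, Z i k w).
Proof.
move=> n1; rewrite ge_max sumr_ge0 ?andbT; last by move=> k _; exact: posmax_ge0.
apply/running_max_le => // k kn.
rewrite (bigD1_seq k) ?iota_uniq ?mem_index_iota ?ltnS//=.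
apply: (@le_trans _ _ (posmax (0, Z i k w))).
  by rewrite !le_max/= lexx !orbT.
by rewrite lerDl sumr_ge0// => j _; exact: posmax_ge0.
Qed.

(** The positive part of S^i_n is at most the sum of those of Z^i_1, ..., Z^i_n, each of mean
    [maxmean i 0]. Independence of the rows allows this bound to be inserted factor by factor. *)
Lemma integral_prod_running_max_le n (c : R) : (1 <= n)%N -> 0 <= c ->
  (\int[P]_w (c * \prod_(i < m) Num.max (S i n w) 0)%:E <=
   (c * \prod_(i < m) (n%:R * maxmean i 0))%:E)%E.
Proof.
move=> n1 c0.
rewrite [leRHS](_ : _ = \int[P]_w (cst c w *
    \prod_(i < m) cst (n%:R * maxmean i 0) w)%:E)%E; last first.
  by rewrite /= integral_cst//= probability_setT mule1.
pose rest j : set ('I_m * nat) := [set ik | (1 <= ik.2 <= n)%N /\ ik.1 != j].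
apply: (integral_prod_replace (G := fun j => cell_gen Z (rest j)) (U := cst c)).
- by [].
- by move=> i w; rewrite le_max lexx orbT.
- by move=> i w; rewrite /= mulr_ge0// maxmean_ge0.
- by move=> j; apply/measurable_wrtP; exact: measurable_cst.
- move=> i j ij; apply/measurable_wrtP/measurable_maxr => //.
  apply/measurable_wrtP; apply: measurable_running_max => // k kn; split=> //=.
- by move=> i j ij; apply/measurable_wrtP; exact: measurable_cst.
move=> j V V0 mV; have mV' := measurable_wrt_measurable mV.
have mZ k : measurable_fun setT (fun w => posmax (0, Z j k w)).
  by apply: measurable_maxr => //; apply: measurable_maxr => //; exact: measurable_funP.
have mS : measurable_fun setT (S j n).
  exact: (measurable_wrt_measurable (measurable_running_max_grid n1)).
apply: (@le_trans _ _ (\int[P]_w \sum_(1 <= k < n.+1)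
    (V w * posmax (0, Z j k w))%:E)%E).
  apply: ge0_le_integral => //.
  - by move=> w _; rewrite lee_fin mulr_ge0// le_max lexx orbT.
  - by apply/measurable_EFinP/measurable_funM => //; exact: measurable_maxr.
  - by apply: emeasurable_sum => k; apply/measurable_EFinP/measurable_funM.
  move=> w _; rewrite sumEFin lee_fin -mulr_sumr ler_wpM2l//.
  exact: posmax_sum_ge.
rewrite ge0_integral_sum//; last 2 first.
- by move=> k; apply/measurable_EFinP/measurable_funM.
- by move=> k w _; rewrite lee_fin mulr_ge0// posmax_ge0.
rewrite big_seq (eq_bigr (fun k => \int[P]_w (V w * maxmean j 0)%:E)%E); last first.
  move=> k; rewrite mem_index_iota ltnS => kn.
  have mVk : measurable_wrt <<s cell_gen Z (other_cells n j k) >> V.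
    apply: measurable_wrtS mV; apply: sub_cell_gen => -[i l] [/= ln ij].
    by split=> //; rewrite xpair_eqE negb_and ij.
  have m0 : measurable_wrt <<s cell_gen Z (other_cells n j k) >> (cst 0 : T -> R).
    by apply/measurable_wrtP; exact: measurable_cst.
  rewrite (integral_cell hindep hiid kn mVk m0 V0 measurable_posmax posmax_ge0).
  by apply: eq_integral => w _; rewrite EFinM maxmeanE.
rewrite -big_seq -ge0_integral_sum//; last 2 first.
- by move=> k; apply/measurable_EFinP/measurable_funM.
- by move=> k w _; rewrite lee_fin mulr_ge0// maxmean_ge0.
rewrite le_eqVlt; apply/orP; left; apply/eqP; apply: eq_integral => w _.
by rewrite sumEFin sumr_const_nat subSS subn0 mulrCA mulr_natl.
Qed.

Lemma integral_reward_le n : (1 <= n)%N ->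
  (\int[P]_w `|reward rho Z n w|%:E <=
   ((n%:R * rho ^+ n) ^+ m * \prod_(i < m) maxmean i 0)%:E)%E.
Proof.
move=> n1; pose c := (rho ^+ n) ^+ m.
have c0 : 0 <= c by rewrite !exprn_ge0// ltW.
have mS i : measurable_fun setT (S i n).
  exact: (measurable_wrt_measurable (measurable_running_max_grid n1)).
have mr := measurable_wrt_measurable (measurable_reward n1).
have -> : (\int[P]_w `|reward rho Z n w|%:E =
    \int[P]_w (c * \prod_(i < m) Num.max (S i n w) 0)%:E)%E.
  apply: ae_eq_integral => //.
  - exact/measurable_EFinP/measurableT_comp.
  - apply/measurable_EFinP/measurable_funM => //.
    by apply: measurable_prod => i _; exact: measurable_maxr.
  apply: filterS ae_pos => w Z0 _; rewrite rewardE -/c.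
  have S0 i : 0 < S i n w by exact: running_max_gt0.
  rewrite ger0_norm; last by rewrite mulr_ge0// prodr_ge0// => i _; exact: ltW.
  by congr (_ * _)%:E; apply: eq_bigr => i _; rewrite (max_idPl (ltW _)).
apply: (le_trans (integral_prod_running_max_le n1 c0)).
rewrite big_split/= prodr_const card_ord.
by rewrite mulrA /c -exprMn [rho ^+ n * _]mulrC.
Qed.

Lemma integrable_reward n : (1 <= n)%N ->
  P.-integrable setT (EFin \o reward rho Z n).
Proof.
move=> n1; apply/integrableP; split.
  apply/measurable_EFinP; exact: (measurable_wrt_measurable (measurable_reward n1)).
by apply: le_lt_trans (integral_reward_le n1) _; rewrite ltry.
Qed.

Lemma reward_gt0 n w : (forall i k, (1 <= k)%N -> 0 < Z i k w) -> (1 <= n)%N ->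
  0 < reward rho Z n w.
Proof.
move=> Z0 n1; rewrite rewardE mulr_gt0 ?exprn_gt0//.
by apply: prodr_gt0 => i _; exact: running_max_gt0.
Qed.

Lemma integral_continuation n A : (1 <= n)%N ->
  <<s cell_gen Z (grid m n) >> A ->
  (\int[P]_(w in A) (continuation n w)%:E =
   \int[P]_(w in A) (reward rho Z n.+1 w)%:E)%E.
Proof.
move=> n1 sA.
have mA : measurable A.
  apply: (smallest_sub (@sigma_algebra_measurable _ T) _ sA).
  exact: cell_gen_measurable.
rewrite -[LHS]integral_indicM// -[RHS]integral_indicM//.
pose c := (rho ^+ n.+1) ^+ m.
have c0 : 0 <= c by rewrite !exprn_ge0// ltW.
pose U (w : T) : R := \1_A w * c.
have U0 w : 0 <= U w by rewrite mulr_ge0.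
have mU : measurable_wrt <<s cell_gen Z (grid m n) >> U.
  by apply/measurable_wrtP/measurable_funM.
rewrite [LHS](_ : _ =
    \int[P]_w (U w * \prod_(i < m) maxmean i (S i n w))%:E)%E; last first.
  by apply: eq_integral => w _; rewrite /continuation mulrA.
(* Where all variables are positive, [posmax] of S^i_n and Z^i_(n+1) is S^i_(n+1). *)
rewrite -integral_next_max//; apply: ae_eq_integral => //.
- apply/measurable_EFinP/measurable_funM.
    exact: measurable_wrt_measurable mU.
  apply: measurable_prod => i _; apply: (measurableT_comp measurable_posmax).
  apply/measurable_fun_pairP; split.
    exact: (measurable_wrt_measurable (measurable_running_max_grid n1)).
  exact: measurable_funP.
- apply/measurable_EFinP/measurable_funM => //.
  exact: (measurable_wrt_measurable (measurable_reward (ltn0Sn n))).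
apply: filterS ae_pos => w Z0 _; rewrite rewardE /U -mulrA.
congr (_ * (_ * _))%:E; apply: eq_bigr => i _.
rewrite running_maxS// /posmax /=; apply/max_idPl.
by rewrite le_max ltW// running_max_gt0.
Qed.

Lemma continuation_ge0 n w : 0 <= continuation n w.
Proof.
rewrite mulr_ge0//; first by rewrite !exprn_ge0// ltW.
by apply: prodr_ge0 => i _; exact: maxmean_ge0.
Qed.

Lemma is_condexp_continuation n : (1 <= n)%N ->
  is_condexp P <<s cell_gen Z (grid m n) >> (reward rho Z n.+1) (continuation n).
Proof.
move=> n1; split; [exact: measurable_continuation| |].
  apply/integrableP; split.
    apply/measurable_EFinP; exact: (measurable_wrt_measurable (measurable_continuation n1)).
  rewrite (eq_integral (fun w => (continuation n w)%:E)); last first.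
    by move=> w _; rewrite /= ger0_norm// continuation_ge0.
  (* Over the whole space the integral is that of the next reward, whence its finiteness. *)
  rewrite integral_continuation//; last exact: (@measurableT _ (g_sigma_algebraType _)).
  rewrite -ge0_fin_numE; last first.
    rewrite -integral_continuation//; last exact: (@measurableT _ (g_sigma_algebraType _)).
    by apply: integral_ge0 => w _; rewrite lee_fin continuation_ge0.
  by apply: integrable_fin_num => //; exact: integrable_reward.
by move=> A sA; exact: integral_continuation.
Qed.

(** * The myopic region and the decay of the expected reward *)

Definition stop_region n : set T :=
  [set w | \prod_(i < m) gfun Z i (S i n w) <= rho ^- m].

Lemma stop_region_sigma n : (1 <= n)%N ->
  <<s cell_gen Z (grid m n) >> (stop_region n).
Proof.
move=> n1.
have mg : measurable_wrt <<s cell_gen Z (grid m n) >>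
    (fun w => \prod_(i < m) gfun Z i (S i n w)).
  apply/measurable_wrtP; apply: measurable_prod => i _.
  apply: measurableT_comp; first exact: measurable_gfun.
  by apply/measurable_wrtP; exact: measurable_running_max_grid.
apply: mg; exists `]-oo, (rho ^- m)]%classic => //.
by rewrite setTI; apply/seteqP; split=> w /=; rewrite in_itv.
Qed.

Lemma stop_regionE n w : (forall i k, (1 <= k)%N -> 0 < Z i k w) -> (1 <= n)%N ->
  stop_region n w <-> continuation n w <= reward rho Z n w.
Proof.
move=> Z0 n1.
have -> : continuation n w =
    (rho ^+ m * \prod_(i < m) gfun Z i (S i n w)) * reward rho Z n w.
  rewrite rewardE /continuation exprS exprMn -!mulrA; congr (_ * _).
  rewrite mulrCA; congr (_ * _); rewrite -big_split/=.
  by apply: eq_bigr => i _; rewrite gfun_maxmean 1?mulrC// running_max_gt0.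
rewrite ger_pMl ?reward_gt0//.
by rewrite /stop_region /= -ler_pdivlMl ?exprn_gt0// mulr1.
Qed.

Lemma stop_region_mono n w : (forall i k, (1 <= k)%N -> 0 < Z i k w) ->
  (1 <= n)%N -> stop_region n w -> stop_region n.+1 w.
Proof.
move=> Z0 n1; apply: le_trans; apply: ler_prod => i _.
rewrite (le_trans ler01 (gfun_ge1 _ _))/=; apply: gfun_anti.
  exact: running_max_gt0.
by rewrite running_maxS// le_max lexx.
Qed.

Lemma reward_cvg0 : (0 < m)%N ->
  (\int[P]_w (reward rho Z n w)%:E)%E @[n --> \oo] --> 0%E.
Proof.
move=> m0; pose M := \prod_(i < m) maxmean i 0.
have sq : Num.sqrt rho < 1 by rewrite -sqrtr1 ltr_sqrt//; case/andP: hrho.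
have sq0 : 0 < Num.sqrt rho by rewrite sqrtr_gt0.
(* Write rho^n = s^n s^n: one factor absorbs n, since the Bernoulli-type bound n (1/s - 1) <= s^(-n)
   gives n s^n <= K, and the other provides geometric decay. *)
pose s := Num.sqrt rho; pose K := (s^-1 - 1)^-1.
have K0 : 0 < K by rewrite invr_gt0 subr_gt0 invf_gt1.
have bern n : n%:R * s ^+ n <= K.
  have h : n%:R * (s^-1 - 1) <= s^-1 ^+ n.
    elim: n => [|n ih]; first by rewrite mul0r.
    rewrite -natr1 mulrDl mul1r exprS.
    have s1 : 1 <= s^-1 ^+ n by rewrite exprn_ege1// invf_ge1// ltW.
    rewrite -[X in _ <= X * _](subrK 1) mulrDl mul1r addrC lerD//.
    by rewrite ler_peMr// subr_ge0 invf_ge1// ltW.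
  rewrite exprVn -ler_pdivlMr ?subr_gt0 ?invf_gt1// in h.
  by rewrite -ler_pdivlMr ?exprn_gt0// mulrC.
have bound n : (1 <= n)%N ->
    (`|\int[P]_w (reward rho Z n w)%:E| <= (geometric (K ^+ m * M) s n)%:E)%E.
  move=> n1; apply: (le_trans (le_abse_integral _ _ _)) => //.
    apply/measurable_EFinP.
    exact: (measurable_wrt_measurable (measurable_reward n1)).
  apply: (le_trans (integral_reward_le n1)); rewrite lee_fin /geometric /=.
  rewrite mulrAC ler_wpM2r//; first by apply: prodr_ge0 => i _; exact: maxmean_ge0.
  have -> : rho ^+ n = s ^+ n * s ^+ n by rewrite -exprMn -expr2 sqr_sqrtr// ltW.
  have sn0 : 0 <= s ^+ n by rewrite exprn_ge0// ltW.
  apply: (@le_trans _ _ (K ^+ m * (s ^+ n) ^+ m)).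
    rewrite -[X in _ <= X]exprMn mulrA lerXn2r ?nnegrE ?mulr_ge0 ?(ltW K0)//.
    by rewrite ler_wpM2r.
  (* Since m >= 1 and s^n <= 1, the power (s^n)^m is at most s^n. *)
  by rewrite ler_wpM2l ?exprn_ge0 ?(ltW K0)// ler_iXnr// exprn_ile1 ?ltW.
have cv : (geometric (K ^+ m * M) s n)%:E @[n --> \oo] --> 0%E.
  apply: cvg_EFin; first exact: nearW.
  by apply: cvg_geometric; rewrite ger0_norm// ltW.
apply/cvg_abse0P; apply: squeeze_cvge cv; last exact: cvg_cst.
near=> n; rewrite abse_ge0/=; apply: bound; near: n; exact: nbhs_infty_ge.
Unshelve. all: by end_near. Qed.

End product_problem.

Theorem mainTheorem5 (d : measure_display) (T : measurableType d)
  (R : realType) (P : probability T R) (m : nat) (rho : R)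
  (Z : 'I_m -> nat -> {RV P >-> R})
  (hm : (1 <= m)%N)
  (hrho : 0 < rho < 1)
  (hindep : independent_sequences Z)
  (hiid : forall i : 'I_m, iid (Z i))
  (hint : forall (i : 'I_m) (n : nat), (1 <= n)%N ->
     P.-integrable setT (EFin \o Z i n))
  (hpos : forall (i : 'I_m) (n : nat), (1 <= n)%N ->
     {ae P, forall w, 0 < Z i n w}) :
  [/\ monotone_case_problem P (filtration Z) (reward rho Z),
      {ae P, forall w, myopic_time P (filtration Z) (reward rho Z) w
                       = tau_star rho Z w} &
      optimal_stopping_time P (filtration Z) (reward rho Z) (tau_star rho Z)].
Proof.
have pos := ae_pos hpos.
have cond n (n1 : (1 <= n)%N) :=
  is_condexp_continuation hrho hindep hiid hint hpos n1.
(* One null set serves all n, so the two infima defining the stopping times coincide off it. *)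
have myopicE : {ae P, forall w, forall n, (1 <= n)%N ->
    myopic_stop P (filtration Z) (reward rho Z) n w <-> stop_region rho Z n w}.
  apply: ae_foralln => -[|n]; first exact: aeW.
  have Gm := @cell_gen_measurable _ _ _ _ _ Z (grid m n.+1).
  apply: filterS2 (condexp_ae Gm (cond n.+1 isT)) pos => w ce Z0 _.
  rewrite /myopic_stop /= ce.
  by have := stop_regionE hrho hint hpos Z0 (ltn0Sn n) => -[h1 h2]; split.
have sub k n : (k <= n)%N -> grid m k `<=` grid m n.
  by move=> kn [i l] /andP[/= l1 lk]; apply/andP; split=> //=; exact: leq_trans kn.
split.
- split=> n n1.
  + exact: measurable_reward.
  + exact: (integrable_reward hrho hindep hiid hint hpos n1).
  + apply: filterS2 myopicE pos => w h Z0 /(h n n1) sn.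
    by apply/(h n.+1 isT); exact: (stop_region_mono hint hpos).
- apply: filterS myopicE => w h; rewrite /myopic_time /tau_star; congr inf_time.
  by apply/seteqP; split=> n [n1 hn]; split=> //; apply/(h n n1).
- apply: (@optimal_inf_time _ _ _ _ (fun n => cell_gen Z (grid m n))
    (reward rho Z) (continuation rho Z) (stop_region rho Z)).
  + by move=> n; exact: cell_gen_measurable.
  + by move=> k n kn; apply: sub_cell_gen; exact: sub.
  + by move=> n n1; exact: (integrable_reward hrho hindep hiid hint hpos n1).
  + exact: cond.
  + by move=> n n1; exact: (stop_region_sigma rho hint hpos n1).
  + by apply: filterS pos => w Z0 n n1; exact/ltW/(reward_gt0 hrho Z0 n1).
  + by apply: filterS pos => w Z0 n n1; exact: (stop_regionE hrho hint hpos Z0 n1).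
  + by apply: filterS pos => w Z0 n n1; exact: (stop_region_mono hint hpos).
  + exact: (reward_cvg0 hrho hindep hiid hint hpos hm).
Qed.
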